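(* Let $z\in(0,1]$ and let $\nu\in\mathbb{R}$ satisfy $z^2\le\nu\le 1$. Then the scheme defined by $A(z)=I-z\,D_0+\frac{\nu}{2}\,\Delta$ together with the first order extrapolation condition $\Phi_1=\Phi_0$ is semi-bounded (with respect to the inner product $(\cdot,\cdot)_H$ for a suitable $h_0>0$). In particular, for every real sequence $\boldsymbol{\Phi}=(\Phi_j)_{j\le 0}\in\ell^2(\mathbb{Z}^-)$, extended by $\Phi_1=\Phi_0$, and with $\Psi_j:=A(z)\Phi_j$ for $j\le 0$, the energy balance is given by $$\sum_{j\le 0}\Psi_j^2\;\le\;\sum_{j\le 0}\Phi_j^2-z\,\Phi_0^2\;\le\;\sum_{j\le 0}\Phi_j^2 .$$
   Context: $\mathbb{Z}^-$ is the set of integers $j\le 0$. Difference operators: $D\Phi_j:=\Phi_j-\Phi_{j-1}$, $D_0\Phi_j:=\frac12(\Phi_{j+1}-\Phi_{j-1})$, $\Delta\Phi_j:=\Phi_{j-1}-2\Phi_j+\Phi_{j+1}$; $I$ is the identity. Inner product: for $h_0>0$, $(\boldsymbol{\Phi},\boldsymbol{\Psi})_H:=\sum_{j\le -1}\Phi_j\Psi_j+h_0\Phi_0\Psi_0$. Set $$T_j:=\begin{pmatrix}\Phi_j\\ D\Phi_{j+1}\end{pmatrix}^T\begin{pmatrix}-z&\frac{\nu-z}{2}\\ \frac{\nu-z}{2}&\frac{\nu(1-z)}{2}\end{pmatrix}\begin{pmatrix}\Phi_j\\ D\Phi_{j+1}\end{pmatrix},$$ $$S_j:=-\frac{\nu-z^2}{2}\left[(D\Phi_j)^2+(D\Phi_{j+1})^2\right]+\frac{\nu^2-z^2}{4}\,(D\Phi_{j+1}-D\Phi_j)^2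 .$$ Semi-boundedness: together with extrapolation conditions defining the ghost value $\Phi_1$ from $(\Phi_j)_{j\le 0}$, $A(z)$ is called semi-bounded with respect to $(\cdot,\cdot)_H$ if, for the given $z\ge0$: (1) the scheme is contractive, i.e. for every real sequence $(\Phi_j)_{j\in\mathbb{Z}}$, with $\Psi_j=A(z)\Phi_j$, one has $\Psi_j^2=\Phi_j^2+T_j-T_{j-1}+S_j$ and $S_j\le0$ for all $j$; and (2) for every sequence $(\Phi_j)_{j\le0}$ extended by the extrapolation condition, the boundary contribution $E:=(1-h_0)\,T_{-1}+h_0\,T_0+h_0\,S_0$ satisfies $E\le 0$. *)

(* Defs.v *)
(* MathComp-Analysis, over an arbitrary [R : realType]. *)
From mathcomp Require Import all_boot all_order all_algebra.
From mathcomp Require Import all_classical all_reals all_analysis.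
Set Implicit Arguments.
Unset Strict Implicit.
Unset Printing Implicit Defensive.
Import Order.TTheory GRing.Theory Num.Theory.
Local Open Scope classical_set_scope.
Local Open Scope ring_scope.

Section Scheme.
Variable R : realType.
Implicit Types (u : int -> R) (z nu h : R) (j : int).

Definition bdiff u j : R := u j - u (j - 1).
Definition cdiff u j : R := (u (j + 1) - u (j - 1)) / 2.
Definition lapl u j : R := u (j - 1) - 2 * u j + u (j + 1).

(* A(z) = I - z D_0 + (nu / 2) Delta *)
Definition scheme z nu u j : R := u j - z * cdiff u j + nu / 2 * lapl u j.

Definition Tvec u j : 'cV[R]_2 := \col_i [:: u j; bdiff u (j + 1)]`_i.

Definition Tmat z nu : 'M[R]_2 :=
  \matrix_(i, k) (nth [::] [:: [:: - z;           (nu - z) / 2];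
                               [:: (nu - z) / 2;  nu * (1 - z) / 2]] i)`_k.

Definition Tform z nu u j : R := ((Tvec u j)^T *m Tmat z nu *m Tvec u j) 0 0.

Definition Sform z nu u j : R :=
  - ((nu - z ^+ 2) / 2) * (bdiff u j ^+ 2 + bdiff u (j + 1) ^+ 2)
  + (nu ^+ 2 - z ^+ 2) / 4 * (bdiff u (j + 1) - bdiff u j) ^+ 2.

Definition Zminus : Type := {j : int | j <= 0}.
Definition Zminus0 : Zminus := exist _ 0 (lexx 0).

(* A half-line sequence with its ghost value is carried by [u : int -> R]; the
   ghost value [u 1] is computed by [g] from the restriction of [u] to j <= 0.
   The values [u j] with j > 1 are unconstrained: they occur neither in
   [scheme z nu u j] for j <= 0 nor in [boundary_term]. *)
Definition extrapolated (g : (Zminus -> R) -> R) u : Prop :=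
  u 1 = g (fun j : Zminus => u (sval j)).

Definition first_order (v : Zminus -> R) : R := v Zminus0.

Definition contractive z nu : Prop :=
  forall u j,
    scheme z nu u j ^+ 2
      = u j ^+ 2 + Tform z nu u j - Tform z nu u (j - 1) + Sform z nu u j
    /\ Sform z nu u j <= 0.

Definition boundary_term z nu h0 u : R :=
  (1 - h0) * Tform z nu u (-1) + h0 * Tform z nu u 0 + h0 * Sform z nu u 0.

(* Semi-boundedness of [scheme z nu] closed by the extrapolation [g], with
   respect to (u, v)_H = \sum_(j <= -1) u_j v_j + h0 u_0 v_0; this inner product
   enters only through its boundary weight [h0]. *)
Definition semi_bounded z nu (g : (Zminus -> R) -> R) h0 : Prop :=
  contractive z nu /\
  forall u, extrapolated g u -> boundary_term z nu h0 u <= 0.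

Definition nonpos_int : set int := [set j | j <= 0].

Definition ell2_nonpos u : Prop :=
  summable nonpos_int (fun j => (u j ^+ 2)%:E).

(* Squared l^2(Z^-) norm, in [\bar R]: +oo when the series diverges. *)
Definition energy u : \bar R := \esum_(j in nonpos_int) (u j ^+ 2)%:E.

End Scheme.

(* Main.v *)
Require Import Defs.
From mathcomp Require Import all_boot all_order all_algebra.
From mathcomp Require Import all_classical all_reals all_analysis.
From mathcomp Require Import ring lra zify.
Import Order.TTheory GRing.Theory Num.Theory.
Import numFieldNormedType.Exports.
Local Open Scope ring_scope.

(** The energy method. Locally the scheme satisfies
      Psi_j^2 = Phi_j^2 + T_j - T_{j-1} + S_j   (lemma local_energy_balance),
    a conservation law with flux T and a source S. The source is dissipative
    because, completing squares,
      S_j = - nu (1 - nu) / 4 (D Phi_{j+1} - D Phi_j)^2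
            - (nu - z^2) / 4 (D Phi_{j+1} + D Phi_j)^2,
    and both coefficients are nonpositive when z^2 <= nu <= 1.

    The weight h0 = 1 gives semi-boundedness: the boundary contribution is then
    T_0 + S_0, and the extrapolation Phi_1 = Phi_0 kills D Phi_1, so that
    T_0 = - z Phi_0^2 <= 0.

    Summing the local balance over -N < j <= 0 telescopes the flux
    (partial_energy_balance):
      sum Psi_j^2 = sum Phi_j^2 - z Phi_0^2 - T_{-N} + sum S_j.
    The flux - T_{-N} is at most 2 (Phi_{-N}^2 + Phi_{1-N}^2)
    (Tform_lower_bound), which tends to 0 for a square summable sequence.
    Dropping S and letting N go to infinity gives the energy estimate. *)

Section Scheme.
Context {R : realType}.
Implicit Types (u : int -> R) (z nu : R) (j : int).

Lemma TformE z nu u j :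
  Tform z nu u j = - z * u j ^+ 2 + (nu - z) * u j * bdiff u (j + 1)
                   + nu * (1 - z) / 2 * bdiff u (j + 1) ^+ 2.
Proof.
rewrite /Tform mxE big_ord_recl big_ord1 !mxE.
by rewrite !big_ord_recl !big_ord0 !mxE /=; field.
Qed.

(** A polynomial identity in Phi_{j-1}, Phi_j, Phi_{j+1}: T_j - T_{j-1}
    absorbs every monomial of Psi_j^2 - Phi_j^2 in which Phi_j multiplies a
    difference, and S collects terms quadratic in the differences alone. *)
Lemma local_energy_balance z nu u j :
  scheme z nu u j ^+ 2
  = u j ^+ 2 + Tform z nu u j - Tform z nu u (j - 1) + Sform z nu u j.
Proof.
rewrite !TformE /Sform /scheme /cdiff /lapl /bdiff subrK addrK.
set a := u (j - 1); set b := u j; set c := u (j + 1).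
by field.
Qed.

(** Written in the variables D Phi_{j+1} - D Phi_j and D Phi_{j+1} + D Phi_j the
    quadratic form S is diagonal, with coefficients whose signs are read off the
    CFL-type condition z^2 <= nu <= 1. *)
Lemma Sform_le0 z nu u j : z ^+ 2 <= nu <= 1 -> Sform z nu u j <= 0.
Proof.
case/andP=> hz2 hnu1; rewrite /Sform.
set p := bdiff u j; set q := bdiff u (j + 1).
have hnu0 : 0 <= nu by apply: le_trans hz2; exact: sqr_ge0.
have -> : - ((nu - z ^+ 2) / 2) * (p ^+ 2 + q ^+ 2)
          + (nu ^+ 2 - z ^+ 2) / 4 * (q - p) ^+ 2
        = - (nu * (1 - nu) / 4 * (q - p) ^+ 2
             + (nu - z ^+ 2) / 4 * (q + p) ^+ 2) by field.
rewrite oppr_le0; apply: addr_ge0; apply: mulr_ge0; rewrite ?sqr_ge0 //.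
  by apply: divr_ge0 => //; apply: mulr_ge0 => //; lra.
by apply: divr_ge0 => //; lra.
Qed.

Lemma contractive_scheme z nu : z ^+ 2 <= nu <= 1 -> contractive z nu.
Proof.
by move=> h u j; split; [exact: local_energy_balance | exact: Sform_le0].
Qed.

(** The ghost value makes D Phi_1 vanish, which leaves only the (negative) upper
    left entry of the flux matrix: the boundary dissipates energy. *)
Lemma Tform0 z nu u :
  extrapolated (@first_order R) u -> Tform z nu u 0 = - (z * u 0 ^+ 2).
Proof.
move=> hu; have u10 : u 1 = u 0 by exact: hu.
by rewrite TformE /bdiff add0r subrr u10 subrr; ring.
Qed.

(** The weight 1 annihilates the contribution of T_{-1}, which has no sign in
    general. *)
Lemma semi_bounded_first_order z nu :
  0 < z -> z ^+ 2 <= nu <= 1 -> semi_bounded z nu (@first_order R) 1.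
Proof.
move=> z0 h; split; first exact: contractive_scheme.
move=> u hu; rewrite /boundary_term subrr mul0r add0r !mul1r Tform0 //.
have hS := Sform_le0 z nu u 0 h.
have hT : 0 <= z * u 0 ^+ 2 by rewrite mulr_ge0 ?sqr_ge0 ?ltW.
lra.
Qed.

(** The flux escaping towards minus infinity is controlled by squares of the
    sequence, so it vanishes in the limit. The constant 2 is not optimal; it
    comes from |nu - z| <= 1 in the cross term and nu <= 1. *)
Lemma Tform_lower_bound z nu u j :
  0 < z <= 1 -> z ^+ 2 <= nu <= 1 ->
  - Tform z nu u j <= 2 * (u j ^+ 2 + u (j + 1) ^+ 2).
Proof.
case/andP=> z0 z1 /andP[hz2 hnu1]; rewrite TformE /bdiff addrK.
set a := u j; set c := u (j + 1).
have nu0 : 0 <= nu by apply: le_trans hz2; exact: sqr_ge0.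
have hq : 0 <= nu * (1 - z) / 2 * (c - a) ^+ 2.
  by rewrite mulr_ge0 ?sqr_ge0 ?divr_ge0 ?mulr_ge0 ?subr_ge0.
have h1 : 0 <= (1 + (nu - z)) * (a + c) ^+ 2.
  by rewrite mulr_ge0 ?sqr_ge0 //; lra.
have h2 : 0 <= (1 - (nu - z)) * (a - c) ^+ 2.
  by rewrite mulr_ge0 ?sqr_ge0 //; lra.
have h3 : 0 <= (1 - nu) * a ^+ 2 by rewrite mulr_ge0 ?sqr_ge0 ?subr_ge0.
have h4 := sqr_ge0 c; have h5 := sqr_ge0 a.
(* 2 (a^2 + c^2) + T = (h1 + h2) / 4 + h3 + hq + a^2 / 2 + 3 c^2 / 2. *)
lra.
Qed.

Lemma oppzS n : - n.+1%:Z = - n%:Z - 1 :> int.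
Proof. lia. Qed.

Lemma partial_energy_balance z nu u N :
  \sum_(0 <= n < N) scheme z nu u (- n%:Z) ^+ 2
  = \sum_(0 <= n < N) u (- n%:Z) ^+ 2
    + Tform z nu u 0 - Tform z nu u (- N%:Z)
    + \sum_(0 <= n < N) Sform z nu u (- n%:Z).
Proof.
elim: N => [|N IH]; first by rewrite !big_nil oppr0; ring.
by rewrite !big_nat_recr //= IH local_energy_balance oppzS; ring.
Qed.

(** Enumerating j <= 0 as 0, -1, -2, ... turns the unordered sum into an
    ordinary series, whose partial sums can be telescoped. *)
Lemma energyE u :
  energy u = (\sum_(0 <= n <oo) (u (- n%:Z) ^+ 2)%:E)%E.
Proof.
rewrite nneseries_esumT; last by move=> n; rewrite lee_fin sqr_ge0.
rewrite /energy (reindex_esum [set: nat] _ (fun n : nat => - n%:Z)) //.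
split=> [n _|m n _ _|j].
- by rewrite /nonpos_int /= oppr_le0.
- by move/oppr_inj => [].
- rewrite /nonpos_int /= => j0; exists `|j|%N => //; lia.
Qed.

Lemma energy_ell2 u : ell2_nonpos u -> energy u \is a fin_num.
Proof.
rewrite /ell2_nonpos /summable => hu; rewrite ge0_fin_numE.
  suff -> : energy u = (\esum_(j in nonpos_int) `|(u j ^+ 2)%:E|)%E by [].
  by apply: eq_esum => j _; rewrite gee0_abs // lee_fin sqr_ge0.
by apply: esum_ge0 => j _; rewrite lee_fin sqr_ge0.
Qed.

Lemma partial_energy_le u N : ell2_nonpos u ->
  \sum_(0 <= n < N) u (- n%:Z) ^+ 2 <= fine (energy u).
Proof.
move=> hu; rewrite -lee_fin fineK ?energy_ell2 // energyE -sumEFin.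
by apply: nneseries_lim_ge => n _ _; rewrite lee_fin sqr_ge0.
Qed.

Lemma ell2_cvg0 u : ell2_nonpos u ->
  ((fun n : nat => u (- n%:Z) ^+ 2) @ \oo --> (0 : R))%classic.
Proof.
move=> hu; apply: cvg_series_cvg_0; apply: nondecreasing_is_cvgn.
  by apply: nondecreasing_series => n _ _; exact: sqr_ge0.
by exists (fine (energy u)) => _ [N _ <-]; exact: partial_energy_le.
Qed.

Lemma energy_scheme_le z nu u :
  0 < z <= 1 -> z ^+ 2 <= nu <= 1 ->
  ell2_nonpos u -> extrapolated (@first_order R) u ->
  (energy (scheme z nu u) <= energy u - (z * u 0 ^+ 2)%:E)%E.
Proof.
move=> hz hnu hl hu; rewrite -(fineK (energy_ell2 u hl)) -EFinB.
set B := fine (energy u) - z * u 0 ^+ 2.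
pose r n := 2 * (u (- n.+1%:Z) ^+ 2 + u (- n%:Z) ^+ 2).
have r0 : (r n @[n --> \oo] --> (0 : R))%classic.
  have h := ell2_cvg0 u hl.
  rewrite -[X in (_ --> X)%classic](mulr0 2) -[X in 2 * X](addr0 0).
  apply: cvgMr; apply: cvgD => //.
  by move: h; rewrite -cvg_shiftS.
have bnd n : \sum_(0 <= k < n.+1) scheme z nu u (- k%:Z) ^+ 2 <= B + r n.
  rewrite partial_energy_balance Tform0 //.
  have := partial_energy_le u n.+1 hl.
  have := Tform_lower_bound z nu u (- n.+1%:Z) hz hnu.
  have -> : - n.+1%:Z + 1 = - n%:Z by lia.
  have : \sum_(0 <= k < n.+1) Sform z nu u (- k%:Z) <= 0.
    by apply: sumr_le0 => k _; exact: Sform_le0.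
  by rewrite /B /r; lra.
rewrite energyE; apply: lime_le.
  by apply: is_cvg_nneseries => n _ _; rewrite lee_fin sqr_ge0.
apply: nearW => N; rewrite sumEFin lee_fin.
have Br : (B + r n @[n --> \oo] --> B)%classic.
  by rewrite -[X in (_ --> X)%classic]addr0; apply: cvgD => //; exact: cvg_cst.
(* The bound B + r n holds for longer and longer sums, all of which dominate the
   partial sum of length N since the terms are nonnegative. *)
apply: (cvgr_to_ge Br); near=> n.
apply: le_trans (bnd n).
rewrite [leRHS](@big_cat_nat _ _ _ N) //=; last first.
  by apply: leqW; near: n; exact: nbhs_infty_ge.
by rewrite lerDl sumr_ge0 // => k _; exact: sqr_ge0.
Unshelve. all: by end_near.
Qed.

End Scheme.

Theorem corollary1 (R : realType) (z nu : R)
    (hz : 0 < z <= 1) (hnu : z ^+ 2 <= nu <= 1) :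
  (exists h0 : R, 0 < h0 /\ semi_bounded z nu (@first_order R) h0) /\
  (forall u : int -> R,
     ell2_nonpos u -> extrapolated (@first_order R) u ->
     (energy (scheme z nu u) <= energy u - (z * u 0 ^+ 2)%:E <= energy u)%E).
Proof.
have /andP[z0 _] := hz; split.
  by exists 1; split; [exact: ltr01 | exact: semi_bounded_first_order].
move=> u hl hu; apply/andP; split; first exact: energy_scheme_le.
rewrite -(fineK (energy_ell2 u hl)) -EFinB lee_fin gerBl.
by rewrite mulr_ge0 ?sqr_ge0 ?ltW.
Qed.
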